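(* Let $n\ge 5$ and $\boldsymbol\lambda\in K_n$. Then the stabilizer $G_{\boldsymbol\lambda}=\{g_\sigma\in G\mid g_\sigma(\boldsymbol\lambda)=\boldsymbol\lambda\}$ is isomorphic, as a group, to the group $\mathcal{A}_{[\boldsymbol\lambda]}$ of linear fractional transformations $h$ with $h([\boldsymbol\lambda])=[\boldsymbol\lambda]$, where $[\boldsymbol\lambda]=\{0,1,\infty,\lambda^1,\dots,\lambda^{n-3}\}$.
   Context: $K_n=\{\boldsymbol\lambda=(\lambda^1,\dots,\lambda^{n-3})\in\mathbb{C}^{n-3}\mid \lambda^i\neq 0,1,\ \lambda^i\neq\lambda^j \text{ for all } i\neq j\}$. For $\boldsymbol\lambda\in K_n$ put $z^{\boldsymbol\lambda}_1=0$, $z^{\boldsymbol\lambda}_2=1$, $z^{\boldsymbol\lambda}_3=\infty$, $z^{\boldsymbol\lambda}_{i+3}=\lambda^i$ for $1\le i\le n-3$. For $\sigma\in S_n$ let $f^{\boldsymbol\lambda}_\sigma$ be the unique linear fractional transformation of $\widehat{\mathbb{C}}=\mathbb{C}\cup\{\infty\}$ with $f^{\boldsymbol\lambda}_\sigma(z^{\boldsymbol\lambda}_{\sigma^{-1}(1)})=0$, $f^{\boldsymbol\lambda}_\sigma(z^{\boldsymbol\lambda}_{\sigma^{-1}(2)})=1$, $f^{\boldsymbol\lambda}_\sigma(z^{\boldsymbol\lambda}_{\sigma^{-1}(3)})=\infty$, and define $g_\sigma:K_n\to K_n$ by $$g_\sigma(\boldsymbol\lambda)=\big(f^{\boldsymbol\lambda}_\sigma(z^{\boldsymbol\lambda}_{\sigma^{-1}(4)}),\dots,f^{\boldsymbol\lambda}_\sigma(z^{\boldsymbol\lambda}_{\sigma^{-1}(n)})\big).$$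 $G=\{g_\sigma\mid\sigma\in S_n\}$ is a group under composition. *)

(* Defs.v *)
From HB Require Import structures.
From mathcomp Require Import all_boot all_order all_algebra all_fingroup.
From mathcomp Require Import boolp classical_sets functions reals.
From mathcomp Require Import complex ring.
Set Implicit Arguments.
Unset Strict Implicit.
Unset Printing Implicit Defensive.
Import Order.TTheory GRing.Theory Num.Theory.
Local Open Scope classical_set_scope.
Local Open Scope ring_scope.
Local Open Scope complex_scope.

(* [None] is the point at infinity. *)
Definition Chat (R : realType) := option R[i].

(* z |-> (a z + b) / (c z + d), with x / 0 = oo and oo |-> a / c. *)
Definition moebius (R : realType) (a b c d : R[i]) (z : Chat R) : Chat R :=
  match z with
  | Some x => if c * x + d == 0 then None else Some ((a * x + b) / (c * x + d))
  | None => if c == 0 then None else Some (a / c)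
  end.

Definition is_lft (R : realType) (h : Chat R -> Chat R) : Prop :=
  exists a b c d : R[i], a * d - b * c != 0 /\ h = moebius a b c d.

Lemma lft_inj (R : realType) (h : Chat R -> Chat R) : is_lft h -> injective h.
Proof.
move=> [a [b [c [d [D ->]]]]].
have Dc : c = 0 -> d = 0 -> False.
  by move=> c0 d0; case/eqP: D; rewrite c0 d0 !mulr0 subr0.
have Hoo (x : R[i]) : moebius a b c d (Some x) <> moebius a b c d None.
  rewrite /=; case: eqP => [e1|/eqP n1]; case: eqP => [c0|/eqP c0] //=.
    by case: (Dc c0); move: e1; rewrite c0 mul0r add0r.
  move=> [] /eqP; rewrite eqr_div // => /eqP E; case/eqP: D.
  have -> : a * d - b * c = a * (c * x + d) - (a * x + b) * c by ring.
  by rewrite E subrr.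
move=> [x|] [y|] //; last 2 first.
- by move/Hoo.
- by move/esym/Hoo.
rewrite /=; case: eqP => [e1|/eqP n1]; case: eqP => [e2|/eqP n2] //=.
- move=> _; congr Some; have c0 : c != 0.
    apply/eqP => c0; apply: (Dc c0).
    by move: e1; rewrite c0 mul0r add0r.
  by apply: (mulfI c0); apply: (addIr d); rewrite e1 e2.
- move=> [] /eqP; rewrite eqr_div // => /eqP E; congr Some.
  have /eqP : (a * d - b * c) * (x - y) = 0.
    have -> : (a * d - b * c) * (x - y)
      = (a * x + b) * (c * y + d) - (a * y + b) * (c * x + d) by ring.
    by rewrite E subrr.
  by rewrite mulf_eq0 (negbTE D) /= subr_eq0 => /eqP.
Qed.

Definition normalizes (R : realType) (p q r : Chat R) (f : Chat R -> Chat R) :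
    Prop :=
  [/\ is_lft f, f p = Some 0, f q = Some 1 & f r = None].

Lemma moebius_scale (R : realType) (k a b c d : R[i]) : k != 0 ->
  moebius (k * a) (k * b) (k * c) (k * d) = moebius a b c d.
Proof.
move=> k0; apply/funext => -[x|] /=; last first.
  by rewrite mulf_eq0 (negbTE k0) /= -mulf_div divff // mul1r.
by rewrite -!mulrA -!mulrDr mulf_eq0 (negbTE k0) /= -mulf_div divff // mul1r.
Qed.

Lemma lft_fix01oo (R : realType) (f : Chat R -> Chat R) :
  normalizes (Some 0) (Some 1) None f -> f = id.
Proof.
move=> [[a [b [c [d [D ->]]]]] /=].
case: eqP => //; rewrite !mulr0 !add0r => /eqP d0 [].
move=> /eqP; rewrite mulf_eq0 invr_eq0 (negbTE d0) orbF => /eqP b0.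
case: eqP => //; rewrite !mulr1 b0 addr0 => /eqP cd [].
case: eqP => // c0 E _; move: E; rewrite c0 add0r => E.
have ad : a = d by rewrite -[a](divfK d0) E mul1r.
rewrite ad; apply/funext => -[x|] /=; last by rewrite eqxx.
by rewrite mul0r add0r addr0 (negbTE d0) mulrAC divff // mul1r.
Qed.

Lemma lft_comp (R : realType) (g f : Chat R -> Chat R) :
  is_lft g -> is_lft f -> is_lft (g \o f).
Proof.
move=> [a [b [c [d [D ->]]]]] [a' [b' [c' [d' [D' ->]]]]].
exists (a * a' + b * c'), (a * b' + b * d'), (c * a' + d * c'),
  (c * b' + d * d'); split.
  have -> : (a * a' + b * c') * (c * b' + d * d')
      - (a * b' + b * d') * (c * a' + d * c')
      = (a * d - b * c) * (a' * d' - b' * c') by ring.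
  by rewrite mulf_neq0.
have key (u v : R[i]) : (u != 0) || (v != 0) ->
  moebius a b c d (if v == 0 then None else Some (u / v)) =
  if c * u + d * v == 0 then None
  else Some ((a * u + b * v) / (c * u + d * v)).
  case: (eqVneq v 0) => [-> | v0 _] /=.
    rewrite orbF => u0; rewrite !mulr0 !addr0 mulf_eq0 (negbTE u0) orbF.
    by case: eqP => // /eqP c0; rewrite -mulf_div divff // mulr1.
  have E (s t : R[i]) : s * (u / v) + t = (s * u + t * v) / v.
    by rewrite mulrDl mulfK // mulrA.
  rewrite !E mulf_eq0 invr_eq0 (negbTE v0) orbF; case: eqP => // /eqP n0.
  by rewrite -mulf_div divff ?invr_neq0 // mulr1.
apply/funext => -[x|]; rewrite [LHS]/= key.
- have E (s t : R[i]) : s * (a' * x + b') + t * (c' * x + d')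
      = (s * a' + t * c') * x + (s * b' + t * d') by ring.
  by rewrite /= !E.
- rewrite -negb_and; apply: contraNN D' => /andP[/eqP u /eqP v].
  have e' : a' * d' - b' * c' = a' * (c' * x + d') - c' * (a' * x + b') by ring.
  by rewrite e' u v !mulr0 subrr.
- by [].
- rewrite -negb_and; apply: contraNN D' => /andP[/eqP u /eqP v].
  by rewrite u v mul0r mulr0 subrr.
Qed.

Lemma lft_inv (R : realType) (f : Chat R -> Chat R) : is_lft f ->
  exists g, [/\ is_lft g, g \o f = id & f \o g = id].
Proof.
have main (a b c d : R[i]) : a * d - b * c != 0 ->
    moebius d (- b) (- c) a \o moebius a b c d = id.
  move=> D; apply/funext => -[x|] /=.
    case: eqP => [e|/eqP n0] /=.
      rewrite oppr_eq0; case: eqP => [c0|/eqP c0].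
        case/eqP: D; move: e; rewrite c0 mul0r add0r => ->.
        by rewrite !mulr0 subr0.
      congr Some; apply: (mulIf (_ : - c != 0)); first by rewrite oppr_eq0.
      rewrite divfK ?oppr_eq0 //; apply/eqP; rewrite -subr_eq0 mulrN opprK.
      by rewrite addrC mulrC e.
    have -> : - c * ((a * x + b) / (c * x + d)) + a
        = (a * d - b * c) / (c * x + d) by field.
    rewrite mulf_eq0 invr_eq0 (negbTE D) (negbTE n0) /=; congr Some.
    by field; rewrite D n0.
  case: eqP => [c0|/eqP c0] /=; first by rewrite c0 oppr0 eqxx.
  have -> : - c * (a / c) + a = 0 by field.
  by rewrite eqxx.
move=> [a [b [c [d [D ->]]]]].
have D' : d * a - (- b) * (- c) != 0 by rewrite mulrNN mulrC.
exists (moebius d (- b) (- c) a); split.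
- by exists d, (- b), (- c), a.
- exact: main.
- by have := main _ _ _ _ D'; rewrite !opprK.
Qed.

Lemma normalizes_unique_exists (R : realType) (p q r : Chat R) :
  p != q -> p != r -> q != r -> exists! f, normalizes p q r f.
Proof.
move=> pq pr qr.
have [f Hf] : exists f, normalizes p q r f.
  case: p q r pq pr qr => [x|] [y|] [w|] // pq pr qr.
  - have {}pq : y - x != 0 by rewrite subr_eq0 eq_sym.
    have {}pr : x - w != 0 by rewrite subr_eq0.
    have {}qr : y - w != 0 by rewrite subr_eq0.
    exists (moebius (y - w) (- x * (y - w)) (y - x) (- w * (y - x))).
    split => /=.
    + exists (y - w), (- x * (y - w)), (y - x), (- w * (y - x)); split=> //.
      have -> : (y - w) * (- w * (y - x)) - - x * (y - w) * (y - x) =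
        (y - w) * (y - x) * (x - w) by ring.
      by rewrite !mulf_neq0.
    + have -> : (y - x) * x + - w * (y - x) = (y - x) * (x - w) by ring.
      rewrite mulf_eq0 (negbTE pq) (negbTE pr) /=; congr Some.
      by rewrite (_ : _ + _ = 0) ?mul0r //; ring.
    + have -> : (y - x) * y + - w * (y - x) = (y - x) * (y - w) by ring.
      rewrite mulf_eq0 (negbTE pq) (negbTE qr) /=; congr Some.
      by field; rewrite pq qr.
    + by rewrite (_ : _ + _ = 0) ?eqxx //; ring.
  - have {}pq : y - x != 0 by rewrite subr_eq0 eq_sym.
    exists (moebius 1 (- x) 0 (y - x)); split => /=.
    + exists 1, (- x), 0, (y - x); split=> //.
      by rewrite mul1r mulr0 subr0.
    + by rewrite mul0r add0r (negbTE pq) mul1r subrr mul0r.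
    + by rewrite mul0r add0r (negbTE pq) mul1r divff.
    + by rewrite eqxx.
  - have {}pr : x - w != 0 by rewrite subr_eq0.
    exists (moebius 1 (- x) 1 (- w)); split => /=.
    + exists 1, (- x), 1, (- w); split=> //.
      by rewrite mul1r mulr1 opprK addrC.
    + by rewrite !mul1r (negbTE pr) subrr mul0r.
    + by rewrite oner_eq0 divff // oner_eq0.
    + by rewrite !mul1r subrr eqxx.
  - have {}qr : y - w != 0 by rewrite subr_eq0.
    exists (moebius 0 (y - w) 1 (- w)); split => /=.
    + exists 0, (y - w), 1, (- w); split=> //.
      by rewrite mul0r mulr1 sub0r oppr_eq0.
    + by rewrite oner_eq0 mul0r.
    + by rewrite !mul1r (negbTE qr) mul0r add0r divff.
    + by rewrite !mul1r subrr eqxx.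
exists f; split=> // g [lg gp gq gr]; case: (Hf) => lf fp fq fr.
have [fi [lfi fif ffi]] := lft_inv lf.
have fiE z : fi (f z) = z by rewrite -[fi (f z)]/((fi \o f) z) fif.
have H : g \o fi = id.
  apply: lft_fix01oo; split; first exact: lft_comp.
  - by rewrite /= -fp (fiE p) gp fp.
  - by rewrite /= -fq (fiE q) gq fq.
  - by rewrite /= -fr (fiE r) gr fr.
by apply/funext => z; rewrite -[LHS]/(id (f z)) -H /= fiE.
Qed.

(* The unique linear fractional transformation sending p, q, r to 0, 1, oo. *)
Definition lft01oo (R : realType) (p q r : Chat R)
    (pq : p != q) (pr : p != r) (qr : q != r) : Chat R -> Chat R :=
  sval (cid (normalizes_unique_exists pq pr qr)).

Lemma lft01ooP (R : realType) (p q r : Chat R)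
    (pq : p != q) (pr : p != r) (qr : q != r) :
  normalizes p q r (lft01oo pq pr qr).
Proof. by rewrite /lft01oo; case: cid => f []. Qed.

(* In all that follows m = n - 3, and the labels 1, ..., n are the ordinals
   0, ..., 3 + m - 1: 1, 2, 3 are [lshift m k] for k = 0, 1, 2, and the others
   are [rshift 3 j] for j < m. *)
Definition inK (R : realType) (m : nat) : pred 'rV[R[i]]_m :=
  fun l => [forall i, (l 0 i != 0) && (l 0 i != 1)] &&
           [forall i, forall j, (i != j) ==> (l 0 i != l 0 j)].

Definition K (R : realType) (m : nat) := {l : 'rV[R[i]]_m | inK l}.

Definition zpt (R : realType) (m : nat) (l : K R m) (i : 'I_(3 + m)) : Chat R :=
  match fintype.split i with
  | inl k => tnth [tuple Some 0; Some 1; None] k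
  | inr j => Some (val l 0 j)
  end.

Lemma zpt_inj (R : realType) (m : nat) (l : K R m) : injective (zpt l).
Proof.
have /andP[/forallP l01 /forallP ll] := valP l.
have neq k (a : 'I_3) : tnth [tuple Some 0; Some 1; None] a <> Some (val l 0 k).
  have /andP[/eqP l0 /eqP l1] := l01 k.
  by case: a => -[|[|[|]]] //= ? []; rewrite /tnth /= => -[] /esym.
move=> i j; rewrite /zpt => E; rewrite -(fintype.splitK i) -(fintype.splitK j).
move: E.
case: (fintype.split i) => a; case: (fintype.split j) => b E.
- congr (fintype.unsplit (inl _)); apply/val_inj; move: E; rewrite !(tnth_nth None).
  case: a b => -[|[|[|]]] //= ? [[|[|[|]]] //= ?] => -[] /eqP;
  by rewrite ?oner_eq0 // eq_sym oner_eq0.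
- by case: (neq _ _ E).
- by case: (neq _ _ (esym E)).
- congr (fintype.unsplit (inr _)); case: E => E; apply/eqP; move: (ll a).
  by move=> /forallP/(_ b); rewrite E eqxx; case: eqP.
Qed.

Lemma zpt_neq (R : realType) (m : nat) (l : K R m) (s : 'S_(3 + m))
    (a b : 'I_3) : a != b ->
  zpt l ((s^-1)%g (lshift m a)) != zpt l ((s^-1)%g (lshift m b)).
Proof. by apply: contra_neq => /zpt_inj/perm_inj/lshift_inj. Qed.

Definition flam (R : realType) (m : nat) (s : 'S_(3 + m)) (l : K R m) :
    Chat R -> Chat R :=
  lft01oo (zpt_neq l s (isT : (0 : 'I_3) != 1))
          (zpt_neq l s (isT : (0 : 'I_3) != 2))
          (zpt_neq l s (isT : (1 : 'I_3) != 2)).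

Lemma flamP (R : realType) (m : nat) (s : 'S_(3 + m)) (l : K R m) :
  normalizes (zpt l ((s^-1)%g (lshift m 0))) (zpt l ((s^-1)%g (lshift m 1)))
             (zpt l ((s^-1)%g (lshift m 2))) (flam s l).
Proof. exact: lft01ooP. Qed.

(* The values below are never oo, as [inK_gvec] and [flam_fin] show, so the
   default 0 is irrelevant. *)
Definition gvec (R : realType) (m : nat) (s : 'S_(3 + m)) (l : K R m) :
    'rV[R[i]]_m :=
  \row_(j < m) odflt 0 (flam s l (zpt l ((s^-1)%g (rshift 3 j)))).

Lemma flam_fin (R : realType) (m : nat) (s : 'S_(3 + m)) (l : K R m)
    (j : 'I_m) :
  flam s l (zpt l ((s^-1)%g (rshift 3 j))) = Some (gvec s l 0 j).
Proof.
rewrite mxE; case E: flam => [//|].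
have [lf _ _ foo] := flamP s l.
move: E; rewrite -foo => /(lft_inj lf)/zpt_inj/perm_inj/eqP.
by rewrite eq_rlshift.
Qed.

Lemma inK_gvec (R : realType) (m : nat) (s : 'S_(3 + m)) (l : K R m) :
  inK (gvec s l).
Proof.
have [lf f0 f1 _] := flamP s l.
apply/andP; split.
  apply/forallP => j; apply/andP; split; apply/eqP => E.
    move: (flam_fin s l j); rewrite E -f0 => /(lft_inj lf)/zpt_inj/perm_inj/eqP.
    by rewrite eq_rlshift.
  move: (flam_fin s l j); rewrite E -f1 => /(lft_inj lf)/zpt_inj/perm_inj/eqP.
  by rewrite eq_rlshift.
apply/forallP => j; apply/forallP => k; apply/implyP; apply: contra_neq => E.
move: (flam_fin s l j); rewrite E -flam_fin.
by move=> /(lft_inj lf)/zpt_inj/perm_inj/rshift_inj.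
Qed.

Definition gmap (R : realType) (m : nat) (s : 'S_(3 + m)) (l : K R m) : K R m :=
  exist _ (gvec s l) (inK_gvec s l).

Definition G (R : realType) (m : nat) : set (K R m -> K R m) :=
  range (@gmap R m).

Definition stabG (R : realType) (m : nat) (l : K R m) :
    set (K R m -> K R m) :=
  [set g | G g /\ g l = l].

Definition bracket (R : realType) (m : nat) (l : K R m) : set (Chat R) :=
  [set Some 0; Some 1; None] `|` range (fun j : 'I_m => Some (val l 0 j)).

Definition lftA (R : realType) (m : nat) (l : K R m) :
    set (Chat R -> Chat R) :=
  [set h | is_lft h /\ h @` bracket l = bracket l].

(* [A] is a group under composition, with the identity map as unit. *)
Definition comp_group (X : Type) (A : set (X -> X)) : Prop :=
  [/\ A id,
      forall u v, A u -> A v -> A (u \o v) &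
      forall u, A u -> exists v, [/\ A v, v \o u = id & u \o v = id]].

Definition comp_group_iso (X Y : Type) (A : set (X -> X)) (B : set (Y -> Y)) :
    Prop :=
  [/\ comp_group A, comp_group B &
      exists phi : (X -> X) -> (Y -> Y), set_bij A B phi /\
        forall u v, A u -> A v -> phi (u \o v) = phi u \o phi v].

(* Main.v *)
Require Import Defs.
From mathcomp Require Import all_boot.
From mathcomp Require Import reals.
From mathcomp Require Import all_order all_algebra all_fingroup.
From mathcomp Require Import boolp classical_sets functions.
From mathcomp Require Import complex.
Set Implicit Arguments.
Unset Strict Implicit.
Unset Printing Implicit Defensive.
Import Order.TTheory GRing.Theory Num.Theory.

(** For every permutation [s], the transformation [flam s l] carries the
marked points of [l] to those of [gmap s l] and permutes the labels by [s]
([flam_zpt]); since a linear fractional transformation is determined by three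
values, this property characterizes both [flam s l] and [gmap s l]
([flam_gmap_eq]). Two consequences follow at once. First, [gmap] turns products
of permutations into composites, and [flam] satisfies the cocycle identity
[flam (t * s) l = flam s (gmap t l) \o flam t l]; when [gmap t] fixes [l] this
is multiplicativity. Second, [gmap s] fixes [l] exactly when some linear
fractional transformation induces [s] on the marked points of [l], and that
transformation is then [flam s l]. So sending [gmap s] to [flam s l] is an
isomorphism from the stabilizer of [l] onto the transformations preserving
[bracket l], as soon as it is well defined.

Well-definedness is where at least five points are needed: it follows from
[gmap s] determining [s] ([gmap_inj]), which fails for four points because the
Klein four-group preserves every cross-ratio. Suppose [gmap s] is the identity and
[s i = j] with [i <> j]. Five points leave room for three labels [a], [b], [c]
outside [{i, j}]. Moving the [j]-th marked point alone changes neither the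
points labelled [a], [b], [c] nor their images, labelled [s a], [s b], [s c],
so it does not change [flam s l]; but it changes the image of the [i]-th
point, which has not moved. This argument needs [j] to label a free coordinate,
and conjugating [s] reduces the general case to that one. *)

(** * Linear fractional transformations *)

Section Transformations.
Local Open Scope classical_set_scope.
Local Open Scope ring_scope.
Variable R : realType.
Implicit Types (f g h : Chat R -> Chat R) (p q r : Chat R).

Lemma lft_id : is_lft (@id (Chat R)).
Proof.
have [p01 [p0oo p1oo]] : Some 0 != Some 1 :> Chat R /\
    Some 0 != None :> Chat R /\ Some 1 != None :> Chat R.
  by split=> //; apply/eqP => -[] /esym/eqP; rewrite oner_eq0.
have H := lft01ooP p01 p0oo p1oo.
by rewrite -(lft_fix01oo H); case: H.
Qed.

(** Post-composing [f] and [g] with the transformation normalizing the common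
images of [p], [q], [r] makes both normalize [p], [q], [r], and there is only
one such transformation. *)
Lemma lft_eq3 f g p q r : is_lft f -> is_lft g ->
  p != q -> p != r -> q != r ->
  f p = g p -> f q = g q -> f r = g r -> f = g.
Proof.
move=> lf lg pq pr qr ep eq er.
have inj x y : x != y -> f x != f y by apply: contra_neq => /(lft_inj lf).
have [lk k0 k1 koo] := lft01ooP (inj _ _ pq) (inj _ _ pr) (inj _ _ qr).
set k := lft01oo _ _ _ in lk k0 k1 koo.
have [h [_ uniq_h]] := normalizes_unique_exists pq pr qr.
have hf : h = k \o f by apply: uniq_h; split; first exact: lft_comp.
have hg : h = k \o g.
  by apply: uniq_h; split; rewrite /= -?ep -?eq -?er //; exact: lft_comp.
apply/funext => z; apply: (lft_inj lk).
by rewrite -[LHS]/((k \o f) z) -hf hg.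
Qed.

End Transformations.

(** * Marked points and the action of permutations *)

Section Action.
Local Open Scope classical_set_scope.
Local Open Scope ring_scope.
Variables (R : realType) (m : nat).
Implicit Types (l : K R m) (s t : 'S_(3 + m)).

Lemma zpt_lshift l (k : 'I_3) :
  zpt l (lshift m k) = tnth [tuple Some 0; Some 1; None] k.
Proof. by rewrite /zpt (fintype.unsplitK (inl k : 'I_3 + 'I_m)). Qed.

Lemma zpt_rshift l (j : 'I_m) : zpt l (rshift 3 j) = Some (val l 0 j).
Proof. by rewrite /zpt (fintype.unsplitK (inr j : 'I_3 + 'I_m)). Qed.

Lemma flam_zpt s l i : flam s l (zpt l i) = zpt (gmap s l) (s i).
Proof.
have [_ f0 f1 foo] := flamP s l.
rewrite -{1}(permK s i) -(fintype.splitK (s i)).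
case: (fintype.split (s i)) => [k|j] /=; last by rewrite flam_fin zpt_rshift.
rewrite zpt_lshift (tnth_nth None); case: k => -[|[|[|//]]] kP.
- by rewrite (_ : Ordinal kP = 0) ?f0 //; exact/val_inj.
- by rewrite (_ : Ordinal kP = 1) ?f1 //; exact/val_inj.
- by rewrite (_ : Ordinal kP = 2) ?foo //; exact/val_inj.
Qed.

Lemma flam_lft s l : is_lft (flam s l).
Proof. by case: (flamP s l). Qed.

(** The first three marked points of [l'] are 0, 1 and infinity, so [h] takes
the three values that define [flam s l]; the other values of [h] are then the
coordinates of [gmap s l]. *)
Lemma flam_gmap_eq s l l' (h : Chat R -> Chat R) : is_lft h ->
  (forall i, h (zpt l i) = zpt l' (s i)) -> flam s l = h /\ gmap s l = l'.
Proof.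
move=> lh hz.
have hV i : h (zpt l ((s^-1)%g i)) = zpt l' i by rewrite hz permKV.
have [lf f0 f1 foo] := flamP s l.
have fh : flam s l = h.
  apply: (lft_eq3 lf lh (zpt_neq l s (isT : (0 : 'I_3) != 1))
    (zpt_neq l s (isT : (0 : 'I_3) != 2))
    (zpt_neq l s (isT : (1 : 'I_3) != 2)));
  by rewrite ?f0 ?f1 ?foo hV zpt_lshift.
split=> //; apply/val_inj/rowP => j.
by have := flam_fin s l j; rewrite fh hV zpt_rshift => -[].
Qed.

Lemma flam_gmap1 l : flam 1%g l = id /\ gmap 1%g l = l.
Proof. by apply: flam_gmap_eq => [|i]; [exact: lft_id | rewrite perm1]. Qed.

Lemma flam_gmapM s t l :
  flam (t * s)%g l = flam s (gmap t l) \o flam t l /\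
  gmap (t * s)%g l = gmap s (gmap t l).
Proof.
apply: flam_gmap_eq => [|i]; first by apply: lft_comp; exact: flam_lft.
by rewrite /= !flam_zpt permM.
Qed.

Lemma gmap1 : gmap 1%g = id :> (K R m -> K R m).
Proof. by apply/funext => l; case: (flam_gmap1 l). Qed.

Lemma gmapM s t : gmap (t * s)%g = gmap s \o gmap t :> (K R m -> K R m).
Proof. by apply/funext => l; case: (flam_gmapM s t l). Qed.

(** * Faithfulness for at least five points *)

(** The new value is a positive number exceeding the sum of the moduli of all
values to be avoided. *)
Lemma exists_notin (r : seq R[i]) : exists x : R[i], x \notin r.
Proof.
pose S := \sum_(y <- r) `|y|; have S0 : 0 <= S by apply: sumr_ge0.
exists (1 + S); apply/negP => xr.
have : `|1 + S| <= S.
  rewrite {2}/S (big_rem _ xr) /= lerDl; exact: sumr_ge0.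
by rewrite ger0_norm ?addr_ge0 // gerDr ler10.
Qed.

Lemma exists_move_zpt l (k : 'I_m) : exists l',
  zpt l' (rshift 3 k) != zpt l (rshift 3 k) /\
  forall i, i != rshift 3 k -> zpt l' i = zpt l i.
Proof.
have [x] := exists_notin (0 :: 1 :: [seq val l 0 j | j <- enum 'I_m]).
rewrite !inE !negb_or => /and3P[x0 x1 xl].
have {}xl j : x != val l 0 j.
  by apply: contraNneq xl => ->; rewrite map_f ?mem_enum.
have /andP[/forallP l01 /forallP ll] := valP l.
pose v := \row_j (if j == k then x else val l 0 j).
have Kv : inK v.
  apply/andP; split; apply/forallP => i.
    by rewrite mxE; case: (i == k); [rewrite x0 | exact: l01].
  apply/forallP => j; apply/implyP => ij; rewrite !mxE.
  case: (i =P k) => [ik|_]; case: (j =P k) => [jk|_] //.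
  - by rewrite ik jk eqxx in ij.
  - by rewrite eq_sym.
  - by have /forallP/(_ j)/implyP := ll i; apply.
exists (exist _ v Kv); split.
  by rewrite !zpt_rshift /= mxE eqxx (inj_eq Some_inj).
move=> i; rewrite -(fintype.splitK i).
case: (fintype.split i) => [a|j] /=; first by rewrite !zpt_lshift.
by rewrite eq_rshift !zpt_rshift /= mxE => /negbTE ->.
Qed.

(** Moving the marked point [j = s i] of [l] yields [l'] for which [flam s] is
the same transformation, because three other labels witness it; evaluating it
at the unmoved [i]-th point gives the [j]-th points of both [l] and [l']. *)
Lemma gmap_id_fix l s i (k : 'I_m) : (2 <= m)%N -> gmap s = @id (K R m) ->
  s i = rshift 3 k -> i = rshift 3 k.
Proof.
move=> m2 sid; set j := rshift 3 k => sij.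
case: (eqVneq i j) => [//|ij]; exfalso.
have [l' [l'j l'E]] := exists_move_zpt l k.
have fz l0 x : flam s l0 (zpt l0 x) = zpt l0 (s x) by rewrite flam_zpt sid.
pose B := [set i; j]%SET.
have /card_gt2P[a [b [c [[aB bB cB] [ab bc ca]]]]] : (2 < #|(~: B)%SET|)%N.
  rewrite -(ltn_add2l #|B|) cardsC card_ord cards2 ij.
  by rewrite addnC ltn_add2l.
have agree x : x \in (~: B)%SET -> flam s l (zpt l x) = flam s l' (zpt l x).
  rewrite !inE negb_or => /andP[xi xj].
  rewrite fz -(l'E x xj) fz l'E // -/j -sij.
  by rewrite (inj_eq perm_inj).
have zn x y : x != y -> zpt l x != zpt l y by rewrite (inj_eq (@zpt_inj _ _ l)).
have E : flam s l = flam s l'.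
  by apply: (lft_eq3 (flam_lft s l) (flam_lft s l') (zn _ _ ab) _ (zn _ _ bc));
    rewrite ?agree // zn // eq_sym.
by move: l'j; rewrite -/j -sij -!fz -E (l'E _ ij) eqxx.
Qed.

(** Only the labels past the third belong to points that can be moved, so the
transposition [t] conjugates [s] into a permutation with such a label as the
image of [t i]. *)
Lemma gmap_id_eq1 l s : (2 <= m)%N -> gmap s = @id (K R m) -> s = 1%g.
Proof.
move=> m2 sid; apply/permP => i; rewrite perm1.
pose j : 'I_(3 + m) := rshift 3 (Ordinal (ltnW m2)).
pose t := tperm (s i) j.
have tsid : gmap (s ^ t)%g = @id (K R m).
  by rewrite conjgE !gmapM sid -gmapM mulVg gmap1.
have tsj : (s ^ t)%g (t i) = j by rewrite permJ tpermL.
by apply: (@perm_inj _ t); rewrite (gmap_id_fix l m2 tsid tsj) tpermL.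
Qed.

Lemma gmap_inj l : (2 <= m)%N -> injective (@gmap R m).
Proof.
move=> m2 s t st; apply/eqP; rewrite eq_mulgV1; apply/eqP.
by apply: (gmap_id_eq1 l m2); rewrite gmapM st -gmapM mulgV gmap1.
Qed.

(** * The two groups and the isomorphism *)

Lemma comp_group_stabG l : comp_group (stabG l).
Proof.
split=> [|u v [[s _ <-] sl] [[t _ <-] tl]|u [[s _ <-] sl]].
- by split=> //; exists 1%g => //; exact: gmap1.
- by split; [exists (t * s)%g => //; exact: gmapM | rewrite /= tl].
- exists (gmap (s^-1)%g); rewrite -!gmapM mulgV mulVg gmap1; split=> //.
  split; first by exists (s^-1)%g.
  by rewrite -{1}sl -[LHS]/((gmap _ \o gmap s) l) -gmapM mulgV gmap1.
Qed.

Lemma comp_group_lftA l : comp_group (lftA l).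
Proof.
split=> [|u v [lu ub] [lv vb]|u [lu ub]].
- by split; [exact: lft_id | exact: image_id].
- by split; [exact: lft_comp | rewrite -image_comp vb ub].
- have [v [lv vu uv]] := lft_inv lu; exists v; split=> //; split=> //.
  by rewrite -{1}ub image_comp vu image_id.
Qed.

Lemma bracket_range l : bracket l = range (zpt l).
Proof.
apply/seteqP; split=> z.
- case=> [[[->|->]|->]|[j _ <-]].
  + by exists (lshift m 0); rewrite ?zpt_lshift.
  + by exists (lshift m 1); rewrite ?zpt_lshift.
  + by exists (lshift m 2); rewrite ?zpt_lshift.
  + by exists (rshift 3 j); rewrite ?zpt_rshift.
- case=> i _ <-; rewrite -(fintype.splitK i).
  case: (fintype.split i) => [k|j] /=; last first.
    by right; exists j; rewrite ?zpt_rshift.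
  rewrite zpt_lshift (tnth_nth None) /=.
  by case: k => -[|[|[|//]]] /= _; left; [left; left|left; right|right].
Qed.

Lemma stab_flam_lftA s l : gmap s l = l -> lftA l (flam s l).
Proof.
move=> sl; split; first exact: flam_lft.
rewrite bracket_range; apply/seteqP; split=> z.
  by case=> _ [i _ <-] <-; exists (s i); rewrite ?flam_zpt ?sl.
case=> i _ <-; exists (zpt l ((s^-1)%g i)); first by exists ((s^-1)%g i).
by rewrite flam_zpt sl permKV.
Qed.

(** A transformation preserving the marked points induces an injective, hence
bijective, map on their labels. *)
Lemma lftA_flam l h : lftA l h -> exists s, gmap s l = l /\ flam s l = h.
Proof.
move=> [lh hb].
have /choice[s0 s0E] : forall i, exists j, h (zpt l i) = zpt l j.
  move=> i; have : bracket l (h (zpt l i)).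
    by rewrite -hb; exists (zpt l i) => //; rewrite bracket_range; exists i.
  by rewrite bracket_range => -[j _ <-]; exists j.
have s0inj : injective s0.
  move=> i j sij; apply: (@zpt_inj _ _ l); apply: (lft_inj lh).
  by rewrite !s0E sij.
exists (perm s0inj).
by have [] := @flam_gmap_eq (perm s0inj) l l h lh (fun i =>
  etrans (s0E i) (congr1 (zpt l) (esym (permE s0inj i)))).
Qed.

Lemma comp_group_iso_stabG_lftA l : (2 <= m)%N ->
  comp_group_iso (stabG l) (lftA l).
Proof.
move=> m2; split; [exact: comp_group_stabG | exact: comp_group_lftA |].
(* Injectivity of [gmap] makes [flam s l] a function of [gmap s] alone. *)
have /choice[phi phiE] : forall g : K R m -> K R m,
    exists f, forall s, gmap s = g -> f = flam s l.
  move=> g; have [[s <-]|no] := pselect (exists s, gmap s = g).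
    by exists (flam s l) => t /(gmap_inj l m2) ->.
  by exists id => s sg; case: no; exists s.
have {}phiE s : phi (gmap s) = flam s l by exact: phiE.
exists phi; split; last first.
  move=> _ _ [[s _ <-] _] [[t _ <-] tl]; rewrite -gmapM !phiE.
  by have [-> _] := flam_gmapM s t l; rewrite tl.
split.
- by move=> _ [[s _ <-] sl]; rewrite phiE; exact: stab_flam_lftA.
- move=> _ _ /set_mem[[s _ <-] sl] /set_mem[[t _ <-] tl]; rewrite !phiE => st.
  congr gmap; apply/permP => i; apply: (@zpt_inj _ _ l).
  by rewrite -{1}sl -flam_zpt st flam_zpt tl.
- move=> h /lftA_flam[s [sl <-]]; exists (gmap s); last exact: phiE.
  by split=> //; exists s.
Qed.

End Action.

Theorem theorem8 (R : realType) (n : nat) (hn : (5 <= n)%N)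
    (lambda : K R (n - 3)) :
  comp_group_iso (stabG lambda) (lftA lambda).
Proof.
by apply: comp_group_iso_stabG_lftA; rewrite leq_subRL // (leq_trans _ hn).
Qed.
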